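(* (Poisson $T_2$-Energy-Casimir Method) Let $X$ be a finite-dimensional Poisson manifold, let $h\colon X\to\mathbb R$ be a smooth Hamiltonian, let $x_e\in X$ be an equilibrium point of the flow generated by $h$, and let $U$ be an open neighbourhood of $x_e$ with respect to which $x_e$ is tame. Let $\{B_i\}_{i=1}^n$ be a smoothing of $T_2^U(x_e)$ at $x_e$. Then $x_e$ is stable if for each $i$ there is a smooth Casimir $C_i$ on $U$ such that the Hessian $d^2\bigl((h+C_i)|B_i\bigr)(x_e)$ is positive or negative definite on $T_{x_e}B_i$.
   Context: The Hamiltonian $h$ generates the vector field on $X$ determined by $\dot f=\{h,f\}$ for all differentiable $f$; its flow is $\phi_t$. An equilibrium $x_e$ is stable if for every open neighbourhood $O$ of $x_e$ there is a neighbourhood $V$ of $x_e$ such that $x\in V$ implies $\phi_t(x)\in O$ for all $t$. For an open set $U\subseteq X$ and $x\in U$, $L^U(x)$ is the (connected) symplectic leaf through $x$ of the Poisson manifold $U$; $Z^U$ is the space of symplectic leaves of $U$ with the quotient topology from $L^U\colon U\to Z^U$. For a topological space $Y$ and $y\in Y$, $T_2(y)$ is the set of $y'\in Y$ such that every neighbourhood of $y$ meets every neighbourhood of $y'$. Define $T_2^U(x)=(L^U)^{-1}\bigl(T_2(L^U(x))\bigr)$, with $T_2(L^U(x))$ taken in $Z^U$. For a manifold $M$, a subset $S\subseteq M$ and $m\in S$: the tangent space $T_mS$ is the subset of $T_mM$ consisting of the derivatives $c'(0)$ of all $C^1$ curves $c(t)$ in $M$ with $c(0)=m$ and $c(t)\in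 S$ for $t\ge 0$. A smoothing of $S$ at $m$ is a finite collection of submanifolds $B_1,\dots,B_n\subseteq M$ (through $m$) such that $S\subseteq\bigcup_{i=1}^nB_i$ and $T_mB_i\subseteq\operatorname{span}(T_mS)$ for $1\le i\le n$. The equilibrium $x_e$ of $h$ is tame (with respect to $U$) if $dh(x_e)$ annihilates $T_{x_e}\bigl(T_2^U(x_e)\bigr)$. A Casimir on $U$ is a continuous function $C\colon U\to\mathbb R$ which is constant on the symplectic leaves of $U$. (Under these hypotheses $x_e$ is a critical point of $(h+C_i)|B_i$, so the Hessian is well defined.) *)

(* Defs.v *)
From HB Require Import structures.
From mathcomp Require Import all_boot all_order all_algebra.
From mathcomp Require Import all_classical all_reals all_analysis.

Set Implicit Arguments.
Unset Strict Implicit.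
Unset Printing Implicit Defensive.

Import Order.TTheory GRing.Theory Num.Theory.
Import numFieldNormedType.Exports.

Local Open Scope classical_set_scope.
Local Open Scope ring_scope.
Local Open Scope quotient_scope.

(* Conventions.  A function or map that mathematically lives on an open set W
   is a total function used only on W.  Manifolds are Hausdorff and second
   countable, of a fixed dimension d (d = 0 allowed), and carry a maximal
   smooth atlas.  The symplectic leaves of U are Weinstein's: x and y are in
   the same leaf iff they are joined in U by finitely many pieces of
   trajectories of locally defined Hamiltonians.  Submanifolds are embedded
   submanifolds, not necessarily closed. *)

Section Calculus.
Context {R : realType} {d : nat}.

Fixpoint Ck (k : nat) (W : set 'rV[R]_d) (f : 'rV[R]_d -> R) : Prop :=
  if k is k'.+1 then
    (forall u, W u -> differentiable f u) /\ (forall v, Ck k' W ('D_v f))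
  else forall u, W u -> {for u, continuous f}.

Definition Cinf (W : set 'rV[R]_d) (f : 'rV[R]_d -> R) : Prop :=
  forall k, Ck k W f.

Definition hessian (f : 'rV[R]_d -> R) (u v w : 'rV[R]_d) : R :=
  'D_v ('D_w f) u.

End Calculus.

Record chart (R : realType) (d : nat) (X : topologicalType) := Chart {
  cdom : set X;
  cmap :> X -> 'rV[R]_d;
  cinv : 'rV[R]_d -> X;
  cdom_open : open cdom;
  cimg_open : open (cmap @` cdom);
  cmap_continuous : forall x, cdom x -> {for x, continuous cmap};
  cinv_continuous : forall u, (cmap @` cdom) u -> {for u, continuous cinv};
  cmapK : forall x, cdom x -> cinv (cmap x) = x }.

Definition transition_smooth (R : realType) (d : nat) (X : topologicalType)
    (a b : chart R d X) : Prop :=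
  forall j : 'I_d,
    Cinf (a @` (cdom a `&` cdom b)) (fun u => b (cinv a u) ord0 j).

Definition compatible (R : realType) (d : nat) (X : topologicalType)
    (a b : chart R d X) : Prop :=
  transition_smooth a b /\ transition_smooth b a.

Record manifold (R : realType) (d : nat) := Manifold {
  carrier :> topologicalType;
  manifold_hausdorff : hausdorff_space carrier;
  manifold_second_countable : @second_countable carrier;
  atlas : set (chart R d carrier);
  atlas_cover : forall x, exists2 a, atlas a & cdom a x;
  atlas_compatible : forall a b, atlas a -> atlas b -> compatible a b;
  atlas_maximal : forall a, (forall b, atlas b -> compatible a b) -> atlas a }.

Section SmoothFunctions.
Context {R : realType} {d : nat} (M : manifold R d).

Definition smooth_on (W : set M) (f : M -> R) : Prop :=
  forall a, atlas a -> Cinf (a @` (cdom a `&` W)) (f \o cinv a).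

Definition smooth_near (p : M) (f : M -> R) : Prop :=
  exists W : set M, [/\ open W, W p & smooth_on W f].

End SmoothFunctions.

(* The bracket is given on germs of smooth functions rather than only on
   C^oo(X), so that it is at once the bracket of every open U of X.  (That
   pbracket f g p depends only on the germs of f and g at p follows from
   pbracketDl, pbracketC and pbracketM, since the functions are total.) *)
Record poisson_manifold (R : realType) (d : nat) := PoissonManifold {
  poisson_carrier :> manifold R d;
  pbracket :
    (poisson_carrier -> R) -> (poisson_carrier -> R) -> poisson_carrier -> R;
  pbracket_smooth : forall p f g, smooth_near p f -> smooth_near p g ->
    smooth_near p (pbracket f g);
  pbracketDl : forall p (c : R) f g k,
    smooth_near p f -> smooth_near p g -> smooth_near p k ->
    pbracket (fun x => c * f x + g x) k p = c * pbracket f k p + pbracket g k p;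
  pbracketC : forall p f g, smooth_near p f -> smooth_near p g ->
    pbracket f g p = - pbracket g f p;
  pbracketM : forall p f g k,
    smooth_near p f -> smooth_near p g -> smooth_near p k ->
    pbracket f (fun x => g x * k x) p
      = pbracket f g p * k p + g p * pbracket f k p;
  pbracket_jacobi : forall p f g k,
    smooth_near p f -> smooth_near p g -> smooth_near p k ->
    pbracket f (pbracket g k) p + pbracket g (pbracket k f) p
      + pbracket k (pbracket f g) p = 0 }.

Section Dynamics.
Context {R : realType} {d : nat} (X : poisson_manifold R d).

Definition open_interval (J : set R) : Prop := open J /\ is_interval J.

Definition trajectory (f : X -> R) (J : set R) (c : R -> X) : Prop :=
  forall t, J t -> {for t, continuous c} /\
    forall g : X -> R, smooth_near (c t) g ->
      is_derive t 1 (g \o c) (pbracket f g (c t)).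

(* phi t x is meaningful for (t, x) in D, the maximal flow domain. *)
Record is_flow (h : X -> R) (D : set (R * X)) (phi : R -> X -> X) : Prop := {
  flow_domain_open : open D;
  flow_domain_interval : forall x, is_interval [set t | D (t, x)];
  flow_domain0 : forall x, D (0, x);
  flow_continuous :
    forall q, D q -> {for q, continuous (fun q : R * X => phi q.1 q.2)};
  flow0 : forall x, phi 0 x = x;
  flow_trajectory :
    forall x, trajectory h [set t | D (t, x)] (fun t => phi t x);
  flow_maximal : forall x (J : set R) (c : R -> X),
    open_interval J -> J 0 -> c 0 = x -> trajectory h J c ->
    forall t, J t -> D (t, x) /\ phi t x = c t }.

Definition equilibrium (D : set (R * X)) (phi : R -> X -> X) (x : X) : Prop :=
  forall t, D (t, x) -> phi t x = x.

Definition stable (D : set (R * X)) (phi : R -> X -> X) (x : X) : Prop :=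
  forall O : set X, open O -> O x ->
    exists2 V : set X, nbhs x V &
      forall y, V y -> forall t, D (t, y) /\ O (phi t y).

End Dynamics.

Section Leaves.
Context {R : realType} {d : nat} (X : poisson_manifold R d) (U : set X).

(* Time runs in either direction: no order is imposed on s and t. *)
Definition hamiltonian_arc (x y : X) : Prop :=
  exists (W : set X) (f : X -> R) (J : set R) (c : R -> X) (s t : R),
    [/\ open W, W `<=` U & smooth_on W f] /\
    [/\ open_interval J, forall r, J r -> W (c r) & trajectory f J c] /\
    [/\ J s, J t, c s = x & c t = y].

Inductive same_leaf (x : X) : X -> Prop :=
  | same_leaf_refl : same_leaf x x
  | same_leaf_step y z : same_leaf x y -> hamiltonian_arc y z -> same_leaf x z.

Lemma same_leaf_trans x y z : same_leaf x y -> same_leaf y z -> same_leaf x z.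
Proof. by move=> xy; elim=> // y' z' _ xy' yz'; exact: same_leaf_step yz'. Qed.

Lemma hamiltonian_arcC x y : hamiltonian_arc x y -> hamiltonian_arc y x.
Proof.
move=> [W [f [J [c [s [t [Wf [Jc [Js Jt cs ct]]]]]]]]].
by exists W, f, J, c, t, s.
Qed.

Lemma same_leafC x y : same_leaf x y -> same_leaf y x.
Proof.
elim=> [|y' z _ y'x /hamiltonian_arcC zy']; first exact: same_leaf_refl.
by apply: same_leaf_trans y'x; apply: same_leaf_step zy'; exact: same_leaf_refl.
Qed.

Definition leaf_rel : rel U := fun x y => `[< same_leaf (\val x) (\val y) >].

Lemma leaf_rel_equiv : equiv_class_of leaf_rel.
Proof.
split=> [x|x y|y x z].
- exact/asboolP/same_leaf_refl.
- by apply/asboolP/asboolP; exact: same_leafC.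
- by move=> /asboolP xy /asboolP yz; exact/asboolP/(same_leaf_trans xy).
Qed.

Canonical leaf_equiv := EquivRelPack leaf_rel_equiv.

Definition leaf_space : topologicalType :=
  quotient_topology {eq_quot leaf_equiv}.

Definition leaf (x : U) : leaf_space := \pi x.

End Leaves.

Definition T2 {Y : topologicalType} (y : Y) : set Y :=
  [set y' | forall A B, nbhs y A -> nbhs y' B -> A `&` B !=set0].

(* x is an element of U; the preimage under leaf is viewed as a subset of X. *)
Definition T2U {R : realType} {d : nat} (X : poisson_manifold R d) (U : set X)
    (x : X) : set X :=
  [set y | exists x' y' : U,
    [/\ \val x' = x, \val y' = y & T2 (leaf x') (leaf y')]].

Definition linspan {R : realType} {V : lmodType R} (A : set V) : set V :=
  [set v | exists (n : nat) (a : 'I_n -> R) (u : 'I_n -> V),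
    (forall i, A (u i)) /\ v = \sum_(i < n) a i *: u i].

Section Tangent.
Context {R : realType} {d : nat} (M : manifold R d).

Definition C1_curve (c : R -> M) (J : set R) : Prop :=
  forall t, J t -> {for t, continuous c} /\
    forall a, atlas a -> cdom a (c t) ->
      (\forall s \near t, derivable (a \o c) s 1) /\
      {for t, continuous ((a \o c)^`()%classic)}.

(* Tangent vectors at p are derivations of germs of smooth functions at p,
   extended by 0 to the functions that are not smooth near p so that equality
   of tangent vectors is plain equality. *)
Definition tvector : lmodType R := (M -> R) -> R^o.

Definition velocity (c : R -> M) : tvector := fun f =>
  if `[< smooth_near (c 0) f >] then (f \o c)^`()%classic 0 else 0.

Definition tangent (S : set M) (m : M) : set tvector :=
  [set v | exists (e : R) (c : R -> M),
    [/\ 0 < e, C1_curve c `]-e, e[, c 0 = m,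
        forall t, 0 <= t < e -> S (c t) & v = velocity c]].

(* The k-dimensional slices of R^d are normalised to R^k x 0. *)
Definition in_slice (k : nat) (u : 'rV[R]_d) : Prop :=
  forall j : 'I_d, (k <= j)%N -> u ord0 j = 0.

Definition slice_chart (B : set M) (k : nat) (a : chart R d M) : Prop :=
  atlas a /\ forall x, cdom a x -> B x <-> in_slice k (a x).

Definition submanifold (k : nat) (B : set M) : Prop :=
  (k <= d)%N /\
  forall p, B p -> exists2 a, slice_chart B k a & cdom a p.

Definition smoothing (S : set M) (m : M) (n : nat) (B : 'I_n -> set M) : Prop :=
  [/\ forall i, B i m /\ exists k, submanifold k (B i),
      S `<=` \bigcup_i B i &
      forall i, tangent (B i) m `<=` linspan (tangent S m)].

(* In a slice chart the first k coordinates are local coordinates of B, and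
   the vectors of R^k x 0 represent the tangent space of B at m.  Definiteness
   at a critical point does not depend on the slice chart. *)
Definition hessian_definite (F : M -> R) (B : set M) (m : M) : Prop :=
  exists (k : nat) (a : chart R d M),
    [/\ (k <= d)%N, slice_chart B k a & cdom a m] /\
    ((forall v, in_slice k v -> v != 0 ->
        0 < hessian (F \o cinv a) (a m) v v) \/
     (forall v, in_slice k v -> v != 0 ->
        hessian (F \o cinv a) (a m) v v < 0)).

End Tangent.

Section EnergyCasimir.
Context {R : realType} {d : nat} (X : poisson_manifold R d).

Definition tame (U : set X) (h : X -> R) (x : X) : Prop :=
  forall v : tvector X, tangent (T2U U x) x v -> v h = 0.

Definition casimir (U : set X) (C : X -> R) : Prop :=
  (forall x, U x -> {for x, continuous C}) /\
  (forall x y, U x -> U y -> same_leaf U x y -> C x = C y).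

End EnergyCasimir.

(* Main.v *)
Require Import Defs.
From mathcomp Require Import all_boot all_order all_algebra.
From mathcomp Require Import all_classical all_reals all_analysis.
From mathcomp Require Import ring.
Import Order.TTheory GRing.Theory Num.Theory.
Import numFieldNormedType.Exports.
Local Open Scope classical_set_scope.
Local Open Scope ring_scope.

(** Two quantities are preserved along a trajectory in U: the energy h, because
{h, h} = 0, and the leaf of U.  Suppose that trajectories starting arbitrarily
close to xe leave a small neighbourhood G of xe with compact closure in U.  Each
of them crosses the compact frontier of G, and at a limit point z of the
crossing points h z = h xe by continuity.  Every neighbourhood of z and every
neighbourhood of xe share a leaf, so the leaves of xe and z cannot be separated
by open sets of the leaf space, that is, z lies in T2U U xe.  Hence xe is
stable as soon as, near xe, it is the only point of T2U U xe on its energy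
level ([T2_isolated_level_stable]).  The compactness argument is carried out
without sequences: the pairs (starting point, crossing point) that are excluded
form a neighbourhood of (xe, z) for every z in the frontier
([T2U_separated] when z is outside T2U U xe, continuity of h otherwise), and
finitely many such neighbourhoods cover the frontier.  A trajectory that never
leaves a compact set is defined for all times ([flow_complete_on_compact]).

The isolation of xe is where the Casimirs and the smoothing enter
([energy_casimir_isolated]).  Real-valued continuous functions on the leaf space
do not distinguish points that cannot be separated, so a Casimir C is constant
on T2U U xe ([casimir_T2U]); in particular dC kills the tangent vectors of
T2U U xe.  By tameness so does dh.  Since the tangent space of B_i is contained
in the span of those vectors, xe is a critical point of h + C_i on B_i.
There the Hessian is definite, so h + C_i takes its value at xe nowhere else on
B_i near xe ([definite_critical_isolated]); on T2U U xe, where C_i is constant,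
this says that h differs from h xe.  As the finitely many B_i cover T2U U xe,
the isolation follows. *)

(** * Smooth functions on open sets of a coordinate space *)

Lemma cvg_sum {R : realType} {T : Type} (F : set_system T) {FF : Filter F}
    (n : nat) (f : 'I_n -> T -> R) (a : 'I_n -> R) :
  (forall i, f i x @[x --> F] --> a i) ->
  \sum_(i < n) f i x @[x --> F] --> \sum_(i < n) a i.
Proof.
move=> fa; apply: (@cvg_big _ _ _ _ xpredT _ _ _ _ f a) => //.
exact: add_continuous.
Qed.

(** The differential of f serves as a differential of g as well, and it is the
only candidate by uniqueness. *)
Lemma near_eq_differentiable {R : realType} {V W : normedModType R}
    (f g : V -> W) (x : V) :
  {near x, f =1 g} -> differentiable f x -> differentiable g x.
Proof.
move=> fg df; have fgx : f x = g x by exact: nbhs_singleton fg.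
have [cdf Ef] := (diff_locallyP _ _).1 df.
have Eg : g \o shift x = cst (g x) + 'd f x +o_ 0 id.
  apply/eqaddoP => e e0; move/eqaddoP : Ef => /(_ e e0).
  have : \forall h \near 0, f (h + x) = g (h + x).
    by have := fg; rewrite (near_shift 0 x) subr0.
  apply: filterS2 => h /= fgh; rewrite -fgx.
  by rewrite !fctE/= fgh.
have dg : 'd g x = 'd f x :> (V -> W) by exact: diff_unique.
by apply/diff_locallyP; rewrite dg.
Qed.

Section Smooth.
Context {R : realType} {d : nat}.
Implicit Types (W : set 'rV[R]_d) (F G : 'rV[R]_d -> R) (u v w : 'rV[R]_d).

Lemma Ck_subset k W W' F : W' `<=` W -> Ck k W F -> Ck k W' F.
Proof.
move=> sW; elim: k F => [|k IH] F /=; first by move=> cF u /sW /cF.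
by move=> [dF kF]; split=> [u /sW /dF //|v]; exact: IH.
Qed.

Lemma Cinf_subset W W' F : W' `<=` W -> Cinf W F -> Cinf W' F.
Proof. by move=> sW cF k; exact: Ck_subset (cF k). Qed.

Lemma Cinf_differentiable W F u : Cinf W F -> W u -> differentiable F u.
Proof. by move=> /(_ 1%N)[dF _] /dF. Qed.

Lemma Cinf_continuous W F u : Cinf W F -> W u -> {for u, continuous F}.
Proof. by move=> cF Wu; exact/differentiable_continuous/Cinf_differentiable/Wu. Qed.

Lemma Cinf_derive W F v : Cinf W F -> Cinf W ('D_v F).
Proof. by move=> cF k; have [_] := cF k.+1; apply. Qed.

Lemma derive_delta F u v : differentiable F u ->
  'D_v F u = \sum_(j < d) v ord0 j * 'D_(delta_mx ord0 j) F u.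
Proof.
move=> dF; rewrite deriveE// {1}(row_sum_delta v) linear_sum/=.
by apply: eq_bigr => j _; rewrite linearZ/= deriveE.
Qed.

(** The difference quotients on the two sides are the same function. *)
Lemma is_derive_line F u v t : derivable F (u + t *: v) v ->
  is_derive t 1 (fun s => F (u + s *: v)) ('D_v F (u + t *: v)).
Proof.
have E : (fun h : R => h^-1 *: (F (u + (h *: (1 : R^o) + t) *: v) - F (u + t *: v)))
  = (fun h => h^-1 *: (F (h *: v + (u + t *: v)) - F (u + t *: v))).
  by apply/funext => h; rewrite [h *: _]mulr1 scalerDl addrCA.
by move=> dF; apply: DeriveDef; rewrite /derivable/derive/= E.
Qed.

(** Directional derivatives at points of the open set W see only the values on
W, so agreement on W passes to all iterated derivatives. *)
Lemma Ck_eq k W F G : open W -> {in W, F =1 G} -> Ck k W F -> Ck k W G.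
Proof.
move=> oW; elim: k F G => [|k IH] F G FG /=.
  move=> cF u Wu; have nFG : {near u, F =1 G}.
    by near=> w; apply: FG; apply/mem_set; near: w; exact: open_nbhs_nbhs.
  suff : G x @[x --> u] --> G u by [].
  rewrite -(FG u (mem_set Wu)); exact: cvg_trans (near_eq_cvg nFG) (cF u Wu).
have nFG u : W u -> {near u, F =1 G}.
  by move=> Wu; near=> w; apply: FG; apply/mem_set; near: w; exact: open_nbhs_nbhs.
move=> [dF kF]; split=> [u Wu|v].
  exact: near_eq_differentiable (nFG u Wu) (dF u Wu).
apply: IH (kF v) => u /set_mem Wu; apply: near_eq_derive; exact: nFG.
Unshelve. all: end_near. Qed.

Lemma CinfD W F G : open W -> Cinf W F -> Cinf W G -> Cinf W (F \+ G).
Proof.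
move=> oW cF cG k; elim: k F G cF cG => [|k IH] F G cF cG /=.
  by move=> u Wu; apply: continuousD; [exact: (cF 0%N)|exact: (cG 0%N)].
have dF H u : Cinf W H -> W u -> differentiable H u by exact: Cinf_differentiable.
split=> [u Wu|v]; first by apply: differentiableD; exact: dF.
apply: (Ck_eq _ _ ('D_v F \+ 'D_v G)) => //.
  move=> u /set_mem Wu; rewrite /= deriveD//; apply: diff_derivable; exact: dF.
by apply: IH; exact: Cinf_derive.
Qed.

End Smooth.

(** * Critical points with a definite Hessian *)

Section Extremum.
Context {R : realType} {d : nat}.
Implicit Types (W : set 'rV[R]_d) (F G : 'rV[R]_d -> R) (u v w : 'rV[R]_d).

Lemma hessian_delta W F u v : open W -> Cinf W F -> W u ->
  hessian F u v v = \sum_(i < d) \sum_(j < d)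
    v ord0 i * (v ord0 j * hessian F u (delta_mx ord0 i) (delta_mx ord0 j)).
Proof.
move=> oW cF Wu; rewrite /hessian derive_delta; last first.
  exact: Cinf_differentiable (Cinf_derive _ _ _ cF) Wu.
apply: eq_bigr => i _; rewrite -mulr_sumr; congr (_ * _).
have -> : 'D_(delta_mx ord0 i) ('D_v F) u = 'D_(delta_mx ord0 i)
    (\sum_(j < d) (v ord0 j \*: 'D_(delta_mx ord0 j) F)) u.
  apply: near_eq_derive; near=> w; rewrite fct_sumE derive_delta//.
  apply: (Cinf_differentiable W) => //; near: w; exact: open_nbhs_nbhs.
have dF j : derivable ('D_(delta_mx ord0 j) F) u (delta_mx ord0 i).
  by apply: diff_derivable; exact: Cinf_differentiable (Cinf_derive _ _ _ cF) Wu.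
rewrite derive_sum => [|j]; last exact: derivableZ.
by apply: eq_bigr => j _; rewrite deriveZ.
Unshelve. all: end_near. Qed.

(** Continuity is joint in the base point and the vector: this is what makes
definiteness stable under moving the base point. *)
Lemma hessian_continuous W F u v : open W -> Cinf W F -> W u ->
  (fun q : 'rV[R]_d * 'rV[R]_d => hessian F q.1 q.2 q.2) @ (u, v)
    --> hessian F u v v.
Proof.
move=> oW cF Wu; rewrite (hessian_delta W)//.
pose G (q : 'rV[R]_d * 'rV[R]_d) : R := \sum_(i < d) \sum_(j < d)
    q.2 ord0 i * (q.2 ord0 j * hessian F q.1 (delta_mx ord0 i) (delta_mx ord0 j)).
apply: (@cvg_trans _ (G @ (u, v))).
  apply: near_eq_cvg; near=> q; rewrite /G (hessian_delta W)//.
  near: q; apply: (@cvg_fst _ _ (nbhs u) (nbhs v)); exact: open_nbhs_nbhs.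
have c2 i : (fun q : 'rV[R]_d * 'rV[R]_d => q.2 ord0 i) @ (u, v) --> v ord0 i.
  apply: (@cvg_comp _ _ _ snd (fun w : 'rV[R]_d => w ord0 i)); first exact: cvg_snd.
  exact: coord_continuous.
suff : G @ (u, v) --> G (u, v) by [].
apply: cvg_sum => i; apply: cvg_sum => j.
apply: cvgM => //; apply: cvgM => //.
apply: (@cvg_comp _ _ _ fst (fun w => hessian F w _ _)); first exact: cvg_fst.
exact: Cinf_continuous (Cinf_derive _ _ _ (Cinf_derive _ _ _ cF)) Wu.
Unshelve. all: end_near. Qed.

Lemma hessianZ W F u v (c : R) : open W -> Cinf W F -> W u ->
  hessian F u (c *: v) (c *: v) = c ^+ 2 * hessian F u v v.
Proof.
move=> oW cF Wu; rewrite !(hessian_delta W)// mulr_sumr; apply: eq_bigr => i _.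
rewrite mulr_sumr; apply: eq_bigr => j _; rewrite !mxE; ring.
Qed.

Lemma slice_sphere_compact k :
  compact [set v : 'rV[R]_d | in_slice k v /\ `|v| = 1].
Proof.
apply: bounded_closed_compact.
  by exists 1; split=> // M M1 v /= [_ v1]; apply: le_trans (ltW M1); rewrite -v1.
rewrite (_ : mkset _ =
    (\bigcap_(j in [set j : 'I_d | (k <= j)%N]) [set v : 'rV[R]_d | v ord0 j = 0])
    `&` [set v | `|v| = 1]); last first.
  by apply/seteqP; split=> v /= [sv v1]; split.
apply: closedI; last first.
  apply: (@closed_comp _ _ (fun v : 'rV[R]_d => `|v|) [set 1]).
    by move=> v _; exact: norm_continuous.
  exact: closed_eq.
apply: closed_bigI => j _.
apply: (@closed_comp _ _ (fun v : 'rV[R]_d => v ord0 j) [set 0]).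
  by move=> v _; exact: coord_continuous.
exact: closed_eq.
Qed.

(** Definiteness is an open condition: by homogeneity it suffices to test the
unit vectors of the slice, which form a compact set.  The factor s, of either
sign, handles positive and negative definiteness together. *)
Lemma hessian_definite_near W F u k (s : R) :
  open W -> Cinf W F -> W u ->
  (forall v, in_slice k v -> v != 0 -> 0 < s * hessian F u v v) ->
  \forall w \near u, forall v, in_slice k v -> v != 0 ->
    0 < s * hessian F w v v.
Proof.
move=> oW cF Wu pos.
have /compact_near_coveringP cov := slice_sphere_compact k.
have near_pos : \forall w \near u,
    [set v | in_slice k v /\ `|v| = 1] `<=` [set v | 0 < s * hessian F w v v].
  apply: (cov _ (nbhs u) (fun w v => 0 < s * hessian F w v v) (nbhs_filter u)).
  move=> v [vk v1].
  have v0 : v != 0 by rewrite -normr_eq0 v1 oner_eq0.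
  have cq : s * hessian F q.2 q.1 q.1 @[q --> (v, u)] --> s * hessian F u v v.
    apply: cvgM; first exact: cvg_cst.
    apply: (@cvg_comp _ _ _ (fun q => (q.2, q.1))
      (fun q : 'rV[R]_d * 'rV[R]_d => hessian F q.1 q.2 q.2)).
      exact: swap_continuous.
    exact: (hessian_continuous W).
  exact: (cvgr_gt _ cq 0 (pos v vk v0)).
near=> w => v vk v0.
have Ww : W w by near: w; exact: open_nbhs_nbhs.
have nv : 0 < `|v| by rewrite normr_gt0.
rewrite -[v](scalerKV (lt0r_neq0 nv)) (hessianZ W)// mulrCA.
apply: mulr_gt0; first by rewrite exprn_gt0.
suff : [set v | 0 < s * hessian F w v v] (`|v|^-1 *: v) by [].
apply: (near near_pos w) => //; split; last first.
  by rewrite normrZ normfV normr_id mulVf// lt0r_neq0.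
by move=> j kj; rewrite mxE vk// mulr0.
Unshelve. all: end_near. Qed.

(** The mean value theorem is applied to r |-> F (u + r v) on [0, 1], and then
to its derivative on [0, s], where s is the point found first. *)
Lemma second_order_mean_value W F u v : Cinf W F ->
  (forall t : R, 0 <= t <= 1 -> W (u + t *: v)) -> 'D_v F u = 0 ->
  exists t s : R, [/\ 0 < t < 1, 0 < s &
    F (u + v) - F u = s * hessian F (u + t *: v) v v].
Proof.
move=> cF Wuv D0.
have dline (G : 'rV[R]_d -> R) (t : R) : Cinf W G -> 0 <= t <= 1 ->
    is_derive t 1 (fun s => G (u + s *: v)) ('D_v G (u + t *: v)).
  move=> cG t01; apply: is_derive_line; apply: diff_derivable.
  by apply: Cinf_differentiable cG _; exact: Wuv.
have cline (G : 'rV[R]_d -> R) (a : R) : Cinf W G -> a <= 1 ->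
    {within `[0, a], continuous (fun s => G (u + s *: v))}.
  move=> cG a1; apply: derivable_within_continuous => t /[!in_itv]/= /andP[t0 ta].
  have t1 : 0 <= t <= 1 by apply/andP; split=> //; exact: le_trans ta a1.
  by have [] := dline G t cG t1.
have t01W (t : R) : t \in `]0, 1[ -> 0 <= t <= 1.
  by rewrite in_itv/= => /andP[/ltW -> /ltW].
have [t t01 Et] := MVT ltr01 (fun x x01 => dline F x cF (t01W x x01))
  (cline F 1 cF (lexx 1)).
have /andP[t0 t1] : 0 < t < 1 by rewrite in_itv in t01.
have cDF := Cinf_derive _ _ v cF.
have t0W (r : R) : r \in `]0, t[ -> 0 <= r <= 1.
  rewrite in_itv/= => /andP[/ltW -> rt] /=.
  by rewrite (le_trans (ltW rt))// ltW.
have [r r0t Er] := MVT t0 (fun x x0t => dline _ x cDF (t0W x x0t))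
  (cline _ t cDF (ltW t1)).
exists r, t; split=> //.
  by move: r0t; rewrite in_itv/= => /andP[-> /lt_trans]; apply.
move: Et Er; rewrite scale1r scale0r addr0 subr0 mulr1 => ->.
by rewrite D0 !subr0 mulrC.
Qed.

(** By the second order mean value formula, F w - F u is a positive multiple of
the Hessian in the direction w - u at an intermediate point, where it is still
definite. *)
Lemma definite_critical_isolated W F u k (s : R) :
  open W -> Cinf W F -> W u ->
  (forall v, in_slice k v -> 'D_v F u = 0) ->
  (forall v, in_slice k v -> v != 0 -> 0 < s * hessian F u v v) ->
  \forall w \near u, in_slice k (w - u) -> w != u -> F w != F u.
Proof.
move=> oW cF Wu crit pos.
have /nbhs_ballP[e /= e0 eP] : nbhs u (W `&` [set w | forall v, in_slice k v ->
    v != 0 -> 0 < s * hessian F w v v]).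
  by apply: filterI; [exact: open_nbhs_nbhs | exact: (hessian_definite_near W)].
near=> w => wk wu; have wu0 : w - u != 0 by rewrite subr_eq0.
have uw (t : R) : 0 <= t <= 1 -> ball u e (u + t *: (w - u)).
  move=> /andP[t0 t1]; rewrite -ball_normE /ball_/= opprD addNKr normrN normrZ.
  apply: (@le_lt_trans _ _ `|w - u|); first by rewrite ger0_norm// ler_piMl.
  suff : ball u e w by rewrite -ball_normE /ball_/= -normrN opprB.
  by near: w; exact: nbhsx_ballx.
have [t [r [/andP[t0 t1] r0 E]]] := second_order_mean_value W F u (w - u) cF
  (fun t t01 => (eP _ (uw t t01)).1) (crit _ wk).
have [|_ /(_ _ wk wu0) +] := eP (u + t *: (w - u)); first by apply: uw; rewrite !ltW.
apply: contraTneq => Fwu; rewrite -leNgt; move: E.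
rewrite [u + _]addrC subrK Fwu subrr => /esym/eqP; rewrite mulf_eq0 gt_eqF//= => /eqP ->.
by rewrite mulr0.
Unshelve. all: end_near. Qed.
End Extremum.

(** * The leaf space *)

Section Leaves.
Context {R : realType} {d : nat} (X : poisson_manifold R d) (U : set X).

Lemma leaf_eq (x y : U) : same_leaf U (\val x) (\val y) -> leaf x = leaf y.
Proof. by move=> xy; apply/eqmodP/asboolP. Qed.

Lemma eq_leaf (x y : U) : leaf x = leaf y -> same_leaf U (\val x) (\val y).
Proof. by move=> /eqmodP/asboolP. Qed.

Lemma leaf_continuous : continuous (@leaf R d X U).
Proof. exact: pi_continuous. Qed.

Lemma continuous_val (Y : topologicalType) (f : X -> Y) :
  (forall x, U x -> {for x, continuous f}) -> continuous (fun x : U => f (\val x)).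
Proof.
move=> cf x; apply: (@continuous_comp _ _ _ (fun x : U => \val x) f).
  exact: initial_continuous.
by apply: cf; exact: set_valP.
Qed.

(** C descends to a continuous function on the leaf space, and its values lie in
a Hausdorff space. *)
Lemma casimir_T2U (C : X -> R) (x y : X) : casimir U C -> T2U U x y -> C y = C x.
Proof.
move=> [cC leafC] [x' [y' [<- <- T2xy]]].
pose Cbar (l : leaf_space U) : R := C (\val (repr l)).
have CbarE (u : U) : Cbar (leaf u) = C (\val u).
  rewrite /Cbar; apply: leafC; [exact: set_valP|exact: set_valP|].
  by apply: (eq_leaf (repr (leaf u)) u); exact: reprK.
have cCbar : continuous Cbar.
  apply/quotient_continuous.
  rewrite (_ : _ \o _ = fun u : U => C (\val u)); last exact/funext.
  exact: continuous_val.
have := @order_hausdorff _ R.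
rewrite -!CbarE => /(_ (Cbar (leaf y')) (Cbar (leaf x'))); apply => A B nA nB.
have [l [/= Bl Al]] := T2xy _ _ (cCbar _ _ nB) (cCbar _ _ nA).
by exists (Cbar l).
Qed.

(** Disjoint neighbourhoods of the two leaves pull back to neighbourhoods of x
and z whose points lie in different leaves. *)
Lemma T2U_separated (x z : X) : open U -> U x -> U z -> ~ T2U U x z ->
  \forall z' \near z & y \near x, ~ same_leaf U y z'.
Proof.
move=> oU Ux Uz nT2.
pose x' : U := SigSub (mem_set Ux); pose z' : U := SigSub (mem_set Uz).
have /existsNP[A /existsNP[B /not_implyP[nA /not_implyP[nB AB]]]] :
    ~ T2 (leaf x') (leaf z') by move=> T2xz; apply: nT2; exists x', z'.
have lift (w : U) (P : set (leaf_space U)) : nbhs (leaf w) P ->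
    \forall y \near \val w, forall y' : U, \val y' = y -> P (leaf y').
  move=> nP; have : nbhs w (@leaf _ _ _ U @^-1` P) by exact: leaf_continuous.
  rewrite nbhsE => -[V [[V' oV' <-] V'w] VP].
  apply: filterS (open_nbhs_nbhs (conj oV' V'w)) => y V'y y' y'y.
  by apply: VP; rewrite /preimage/= -y'y in V'y *.
exists ([set w | U w /\ forall y' : U, \val y' = w -> B (leaf y')],
        [set y | U y /\ forall y' : U, \val y' = y -> A (leaf y')]).
  split; apply: filterI; try exact: open_nbhs_nbhs.
    exact: (lift z').
  exact: (lift x').
move=> [w y] [/= [Uw Bw] [Uy Ay]] yw; apply: AB.
exists (leaf (SigSub (mem_set Uw) : U)); split; last exact: Bw.
by rewrite -(leaf_eq (SigSub (mem_set Uy))) //; exact: Ay.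
Qed.
End Leaves.

(** * Charts and curves *)

Lemma continuous_mx {R : realType} {T : topologicalType} {m n : nat}
    (f : T -> 'M[R]_(m, n)) (t : T) :
  (forall i j, {for t, continuous (fun s => f s i j)}) -> {for t, continuous f}.
Proof.
move=> fij A [P nP PA].
have : \forall s \near t, forall ij : 'I_m * 'I_n, P ij.1 ij.2 (f s ij.1 ij.2).
  by apply: filter_forall => ij; exact: (fij ij.1 ij.2 _ (nP _ _)).
by apply: filterS => s Ps; apply: PA => i j; exact: (Ps (i, j)).
Qed.

Section Charts.
Context {R : realType} {d : nat} (X : topologicalType) (a : chart R d X).

Lemma chart_image_open (V : set X) : open V -> open (a @` (cdom a `&` V)).
Proof.
move=> oV; rewrite openE => _ [x [ax Vx] <-].
have ux : (a @` cdom a) (a x) by exists x.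
have nA : \forall u \near a x, (a @` cdom a) u.
  by apply: open_nbhs_nbhs; split; [exact: cimg_open|].
have nV : \forall u \near a x, V (cinv a u).
  apply: (cinv_continuous ux); rewrite cmapK//; exact: open_nbhs_nbhs.
apply: filterS2 nA nV => _ [y ay <-]; rewrite cmapK// => Vy.
by exists y.
Qed.

Lemma compact_nbhs (p : X) (V : set X) : cdom a p -> nbhs p V ->
  exists (K G : set X), [/\ compact K, open G, G p, G `<=` K & K `<=` V].
Proof.
move=> ap; rewrite nbhsE => -[V' [oV' V'p] V'V].
have : nbhs (a p) (a @` (cdom a `&` V')).
  by apply: open_nbhs_nbhs; split; [exact: chart_image_open | exists p].
move=> /nbhs_closedballP[e eV]; pose Kb := closed_ball (a p) e%:num.
have cK : compact (cinv a @` Kb).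
  apply: continuous_compact.
    apply: continuous_in_subspaceT => u /set_mem /eV[x [ax _] <-].
    by apply: cinv_continuous; exists x.
  apply: bounded_closed_compact; last exact: closed_ball_closed.
  rewrite /Kb closed_ballE//; exists (`|a p| + e%:num); split=> // r er u /=.
  rewrite /closed_ball_/= => ue; apply: le_trans (ltW er).
  by rewrite -lerBlDl (le_trans (lerB_dist _ _))// distrC.
pose G := cdom a `&` a @^-1` ball (a p) e%:num.
exists (cinv a @` Kb), G; split=> //.
- rewrite openE => x [ax bx]; apply: filterI.
    by apply: open_nbhs_nbhs; split; [exact: cdom_open|].
  apply: (cmap_continuous ax); apply: open_nbhs_nbhs; split=> //; exact: ball_open.
- move=> x [ax bx]; exists (a x); last exact: cmapK.
  exact: subset_closed_ball.
by move=> _ [u /eV[x [ax V'x] <-] <-]; rewrite cmapK//; exact: V'V.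
Qed.
End Charts.

Section Curves.
Context {R : realType} {d : nat} (M : manifold R d).

Lemma smooth_near_chart (f : M -> R) (a : chart R d M) p :
  atlas a -> cdom a p -> smooth_near p f -> differentiable (f \o cinv a) (a p).
Proof.
move=> aa ap [W [oW Wp sf]].
by apply: (Cinf_differentiable _ _ _ (sf a aa)); exists p.
Qed.

Lemma smooth_onT_near (f : M -> R) p : smooth_on setT f -> smooth_near p f.
Proof. by exists setT; split=> //; exact: openT. Qed.

Lemma smooth_near_continuous (f : M -> R) p :
  smooth_near p f -> {for p, continuous f}.
Proof.
move=> sf; have [a aa ap] := atlas_cover p.
have cfa : {for p, continuous ((f \o cinv a) \o a)}.
  apply: continuous_comp; first exact: cmap_continuous.
  by apply: differentiable_continuous; exact: smooth_near_chart.
have E : {near p, (f \o cinv a) \o a =1 f}.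
  have : \forall y \near p, cdom a y.
    by apply: open_nbhs_nbhs; split; [exact: cdom_open|].
  by apply: filterS => y ay; rewrite /= cmapK.
suff : f y @[y --> p] --> f p by [].
by rewrite -(nbhs_singleton E); exact: cvg_trans (near_eq_cvg E) cfa.
Qed.

(** Chain rule through a chart around c t. *)
Lemma C1_curve_derivable (c : R -> M) J t (f : M -> R) :
  C1_curve c J -> J t -> smooth_near (c t) f -> derivable (f \o c) t 1.
Proof.
move=> Cc Jt sf; have [cc dc] := Cc t Jt.
have [a aa act] := atlas_cover (c t).
have [dac _] := dc a aa act.
have : derivable ((f \o cinv a) \o (a \o c)) t 1.
  apply/derivable1_diffP; apply: differentiable_comp.
    by apply/derivable1_diffP; exact: nbhs_singleton dac.
  exact: smooth_near_chart.
apply: near_eq_derivable.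
have : \forall s \near t, cdom a (c s).
  by apply: cc; apply: open_nbhs_nbhs; split; [exact: cdom_open|].
by apply: filterS => s acs; rewrite /= cmapK.
Qed.

(** Curves are constrained to S for nonnegative times only, so the derivative,
which exists by smoothness of f, is computed as a right derivative. *)
Lemma tangent_constant (S : set M) (m : M) (f : M -> R) :
  smooth_near m f -> (forall x, S x -> f x = f m) ->
  forall v, tangent S m v -> v f = 0.
Proof.
move=> sf fS _ [e [c [e0 Cc c0 Sc ->]]].
rewrite /velocity c0; case: asboolP => // _.
have J0 : `]-e, e[%classic (0 : R) by rewrite /= in_itv/= oppr_lt0 e0.
have dfc : derivable (f \o c) 0 1.
  by apply: C1_curve_derivable Cc J0 _; rewrite c0.
rewrite /derive1 cvg_at_rightE; last first.
  move: dfc; rewrite /derivable; under eq_fun do rewrite [_ *: 1]mulr1; exact.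
apply: lim_near_cst => //; near=> s.
rewrite /= addr0 c0 (fS (c s)) ?subrr ?scaler0//; apply: Sc; apply/andP; split.
  by near: s; exact: nbhs_right_ge.
by near: s; exact: nbhs_right_lt.
Unshelve. all: end_near. Qed.

Lemma linspan_vanish (A : set (tvector M)) (f : M -> R) :
  (forall v, A v -> v f = 0) -> forall v, linspan A v -> v f = 0.
Proof.
move=> Af v [n [a [u [Au ->]]]]; rewrite fct_sumE big1// => i _.
by rewrite fctE/= Af// scaler0.
Qed.

End Curves.

Section SliceCurves.
Context {R : realType} {d : nat} (M : manifold R d).

(** Read in another chart, a straight line of the chart a is the image of a line
under the smooth transition map. *)
Lemma chart_line_C1 (a : chart R d M) (u v : 'rV[R]_d) (J : set R) :
  atlas a -> (forall t, J t -> (a @` cdom a) (u + t *: v)) ->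
  C1_curve (fun t => cinv a (u + t *: v)) J.
Proof.
move=> aa Ja t Jt; have at_ := Ja t Jt.
have cline s : {for s, continuous (fun s : R => u + s *: v)}.
  apply: continuousD; first exact: cvg_cst.
  exact: scalel_continuous.
split; first by apply: continuous_comp (cline t) _; exact: cinv_continuous.
move=> b bb bct.
pose W := a @` (cdom a `&` cdom b).
have oW : open W by apply: chart_image_open; exact: cdom_open.
have Wt : W (u + t *: v).
  by case: at_ bct => x ax <-; rewrite cmapK// => bx; exists x.
have Wnear : \forall s \near t, W (u + s *: v).
  by apply: cline; exact: open_nbhs_nbhs.
pose F j (w : 'rV[R]_d) : R := b (cinv a w) ord0 j.
have sF j : Cinf W (F j) by have [sab _] := atlas_compatible aa bb; exact: sab.
have dF j s : W (u + s *: v) ->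
    is_derive s 1 (fun s => F j (u + s *: v)) ('D_v (F j) (u + s *: v)).
  move=> Ws; apply: is_derive_line; apply: diff_derivable.
  exact: Cinf_differentiable (sF j) Ws.
have dbc s : W (u + s *: v) ->
    derivable (b \o (fun t => cinv a (u + t *: v))) s 1.
  move=> Ws; apply/derivable_mxP => i j; rewrite ord1.
  by have [] := dF j s Ws.
split; first by apply: filterS Wnear => s; exact: dbc.
pose dc : R -> 'rV[R]_d := (b \o (fun t => cinv a (u + t *: v)))^`()%classic.
have E : {near t, (fun s => \row_j 'D_v (F j) (u + s *: v)) =1 dc}.
  apply: filterS Wnear => s Ws; rewrite /dc derive1E derive_mx; last exact: dbc.
  by apply/rowP => j; rewrite !mxE; have [_ <-] := dF j s Ws.
have cE : {for t, continuous (fun s : R => \row_j 'D_v (F j) (u + s *: v))}.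
  apply: continuous_mx => i j.
  have -> : (fun s : R => (\row_j 'D_v (F j) (u + s *: v)) i j)
      = 'D_v (F j) \o (fun s => u + s *: v).
    by apply/funext => s; rewrite mxE.
  apply: continuous_comp (cline t) _.
  exact: Cinf_continuous (Cinf_derive _ _ _ (sF j)) Wt.
suff : dc x @[x --> t] --> dc t by [].
by rewrite -(nbhs_singleton E); exact: cvg_trans (near_eq_cvg E) cE.
Qed.

(** The tangent vector is the velocity of the straight line through a m in the
direction v, which stays in the slice and hence in B. *)
Lemma slice_tangent (B : set M) k (a : chart R d M) m v :
  slice_chart B k a -> cdom a m -> B m -> in_slice k v ->
  exists2 w, tangent B m w &
    forall f, smooth_near m f -> w f = 'D_v (f \o cinv a) (a m).
Proof.
move=> [aa aB] am Bm vk; pose c t := cinv a (a m + t *: v).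
have c0 : c 0 = m by rewrite /c scale0r addr0 cmapK.
have [e e0 eA] : exists2 e : R, 0 < e &
    forall t, `|t| < e -> (a @` cdom a) (a m + t *: v).
  have : \forall t \near (0 : R), (a @` cdom a) (a m + t *: v).
    have cl : {for (0 : R), continuous (fun s : R => a m + s *: v)}.
      by apply: continuousD; [exact: cvg_cst | exact: scalel_continuous].
    apply: cl; rewrite scale0r addr0; apply: open_nbhs_nbhs.
    by split; [exact: cimg_open | exists m].
  move=> /nbhs_ballP[e e0 eA]; exists e => // t te; apply: eA.
  by rewrite -ball_normE /ball_/= sub0r normrN.
exists (velocity c).
  exists e, c; split=> //.
    apply: chart_line_C1 => // t; rewrite /= in_itv/= -ltr_norml; exact: eA.
  move=> t /andP[t0 te]; have [|x ax xE] := eA t; first by rewrite ger0_norm.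
  rewrite /c -xE cmapK//; apply/(aB x ax) => j kj.
  by rewrite xE !mxE vk// mulr0 addr0; exact: (aB m am).1.
move=> f sf; rewrite /velocity c0; case: asboolP => // _.
rewrite derive1E.
have [] := @is_derive_line R d (f \o cinv a) (a m) v 0; last first.
  by move=> _; rewrite scale0r addr0.
rewrite scale0r addr0; apply: diff_derivable; exact: smooth_near_chart.
Qed.

End SliceCurves.

(** * Paths leaving an open set *)

Section Exit.
Context {R : realType} {T : topologicalType}.
Implicit Types (c : R -> T) (G : set T).

(** The infimum t of the times spent outside G works: G is open, so the point
reached at time t is itself outside, while it is a limit of earlier points. *)
Lemma first_exit c G (b : R) : open G -> 0 <= b ->
  (forall s, 0 <= s <= b -> {for s, continuous c}) -> G (c 0) -> ~ G (c b) ->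
  exists t, [/\ 0 <= t <= b, ~ G (c t) &
    forall s, 0 <= s <= t -> closure G (c s)].
Proof.
move=> oG b0 cc G0 Gb; pose E := [set s | 0 <= s <= b /\ ~ G (c s)].
have Eb : E b by split=> //; rewrite b0 lexx.
have lE : lbound E 0 by move=> s [/andP[s0 _] _].
have hE : has_inf E by split; [exists b | exists 0].
pose t := inf E.
have t0 : 0 <= t by exact: lb_le_inf hE.1 lE.
have tb : t <= b by exact: ge_inf hE.2 b Eb.
have before s : 0 <= s -> s < t -> G (c s).
  move=> s0 st; apply: contrapT => Gs.
  have : E s by split=> //; rewrite s0 (le_trans (ltW st)).
  by move=> /(ge_inf hE.2); rewrite leNgt st.
have ct : {for t, continuous c} by apply: cc; rewrite t0.
have Gt : ~ G (c t).
  move=> Gt; have : nbhs t (c @^-1` G) by apply: ct; exact: open_nbhs_nbhs.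
  move=> /nbhs_ballP[e /= e0 eG].
  have [s Es st] : exists2 s, E s & s < t + e.
    by apply: inf_lt; [exists b | rewrite ltrDl].
  have ts : t <= s by exact: ge_inf hE.2 s Es.
  apply: Es.2; apply: eG; rewrite -ball_normE /ball_/= distrC ger0_norm ?subr_ge0//.
  by rewrite ltrBlDl.
exists t; split=> [||s /andP[s0 st]]//; first by rewrite t0.
have [st'|ts] := ltP s t; first exact/subset_closure/before.
have -> : s = t by apply/eqP; rewrite eq_le st.
have tpos : 0 < t by rewrite lt_neqAle t0 andbT; apply: contra_notN Gt => /eqP <-.
move=> N /ct /nbhs_ballP[e /= e0 eN].
exists (c (Num.max 0 (t - e / 2))); split.
  by apply: before; rewrite ?le_max ?lexx// gt_max tpos/= gtrBl divr_gt0.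
apply: eN; rewrite -ball_normE /ball_/= ger0_norm.
  by rewrite ltrBlDl -ltrBlDr lt_max; apply/orP; right; rewrite ltrD2l ltrN2 gtr_pMr// invf_lt1// ltr1n.
by rewrite subr_ge0 ge_max t0 gerBl ltW// divr_gt0.
Qed.

(** The exit takes place at a if s < 0 and at b otherwise; phrasing it with an
interval around 0 allows later arguments to ignore the direction of time. *)
Lemma exit_interval c G (J : set R) (s : R) : is_interval J -> J 0 -> J s ->
  (forall t, J t -> {for t, continuous c}) -> open G -> G (c 0) -> ~ G (c s) ->
  exists a b : R, [/\ J a, J b, a <= 0 <= b,
    forall t, a <= t <= b -> closure G (c t) &
    exists2 t, a <= t <= b & ~ G (c t)].
Proof.
move=> iJ J0 Js cc oG G0 Gs; have [s0|s0] := leP 0 s.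
  have [t [/andP[t0 ts] Gt clt]] := first_exit c G s oG s0
    (fun t ts => cc t (iJ 0 s J0 Js t ts)) G0 Gs.
  exists 0, t; split=> //; first by apply: (iJ 0 s) => //; rewrite t0.
    by rewrite lexx.
  by exists t => //; rewrite t0 lexx.
have [||||t [/andP[t0 ts] Gt clt]] := first_exit (c \o -%R) G (- s) oG.
- by rewrite oppr_ge0 ltW.
- move=> t /andP[t0 ts]; apply: continuous_comp; first exact: opp_continuous.
  by apply: cc; apply: (iJ s 0) => //; rewrite oppr_le0 t0 lerNr ts.
- by rewrite /= oppr0.
- by rewrite /= opprK.
exists (- t), 0; split=> //.
- by apply: (iJ s 0) => //; rewrite oppr_le0 t0 lerNr ts.
- by rewrite oppr_le0 t0 lexx.
- move=> r /andP[tr r0]; rewrite -[r]opprK; apply: clt.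
  by rewrite oppr_ge0 r0 lerNl.
by exists (- t) => //; rewrite lexx oppr_le0.
Qed.
End Exit.

(** * Trajectories and the flow *)

Section Trajectories.
Context {R : realType} {d : nat} (X : poisson_manifold R d).
Implicit Types (h f : X -> R) (J : set R) (c : R -> X).

Lemma trajectory_subset h J J' c : J' `<=` J -> trajectory h J c -> trajectory h J' c.
Proof. by move=> sJ hc t /sJ/hc. Qed.

Lemma trajectory_shift h J c (s : R) : trajectory h J c ->
  trajectory h [set t | J (t + s)] (fun t => c (t + s)).
Proof.
move=> hc t Jts; have [cc dc] := hc _ Jts; split=> [|g sg].
  apply: (@continuous_comp _ _ _ (fun t => t + s) c) => //.
  by apply: continuousD; [exact: cvg_id|exact: cvg_cst].
have [dg <-] := dc g sg.
have E : (fun r : R => r^-1 *: ((g \o (fun t => c (t + s))) (r *: (1 : R^o) + t)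
    - (g \o (fun t => c (t + s))) t))
  = (fun r => r^-1 *: ((g \o c) (r *: (1 : R^o) + (t + s)) - (g \o c) (t + s))).
  by apply/funext => r; rewrite /= addrA.
by apply: DeriveDef; rewrite /derivable/derive/= E.
Qed.

Lemma open_interval_shift J (s : R) : open_interval J ->
  open_interval [set t | J (t + s)].
Proof.
move=> [oJ iJ]; split.
  apply: (@open_comp _ _ (fun t => t + s) J) => // t _.
  by apply: continuousD; [exact: cvg_id|exact: cvg_cst].
move=> x y Jx Jy z /andP[xz zy]; apply: iJ Jx Jy _ _.
by rewrite !lerD2r xz.
Qed.

(** Antisymmetry of the bracket gives {h, h} = 0. *)
Lemma energy_conserved h J c s t : smooth_on setT h -> is_interval J ->
  trajectory h J c -> J s -> J t -> h (c s) = h (c t).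
Proof.
move=> sh; wlog st : s t / s <= t.
  by move=> H; have [/H//|/ltW/H] := leP s t => H' *; exact/esym/H'.
move=> iJ hc Js Jt.
have d0 r : s <= r <= t -> is_derive r 1 (h \o c) 0.
  move=> srt; have sp p := smooth_onT_near _ h p sh.
  have [_ /(_ h (sp _))] := hc r (iJ s t Js Jt r srt).
  suff -> : pbracket h h (c r) = 0 by [].
  by apply/eqP; rewrite -eqNr -pbracketC.
have st_open r : r \in `]s, t[ -> is_derive r 1 (h \o c) 0.
  by rewrite in_itv/= => /andP[/ltW sr /ltW rt]; apply: d0; rewrite sr.
have cst : {within `[s, t], continuous (h \o c)}.
  apply: derivable_within_continuous => r; rewrite in_itv/= => srt.
  by have [] := d0 r srt.
have [r _] := MVT_segment st st_open cst.
by rewrite mul0r => /eqP; rewrite subr_eq0 => /eqP.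
Qed.

(** A Hamiltonian arc has to stay in U on an open time interval; since U
and J are open, [a, b] can be enlarged slightly. *)
Lemma trajectory_same_leaf (U : set X) h J c (a b s t : R) :
  open U -> smooth_on setT h -> open_interval J -> trajectory h J c ->
  J a -> J b -> (forall r, a <= r <= b -> U (c r)) ->
  a <= s <= b -> a <= t <= b -> same_leaf U (c s) (c t).
Proof.
move=> oU sh [oJ iJ] hc Ja Jb Uc sab tab.
have near_end r : J r -> U (c r) ->
    exists2 e : R, 0 < e & forall q, `|r - q| < e -> J q /\ U (c q).
  move=> Jr Ur; have : nbhs r (J `&` c @^-1` U).
    apply: filterI; first exact: open_nbhs_nbhs.
    by apply: (hc r Jr).1; exact: open_nbhs_nbhs.
  by move=> /nbhs_ballP[e e0]; rewrite -ball_normE => eJ; exists e.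
have ab : a <= b by case/andP: sab; exact: le_trans.
have [ea ea0 eaP] : exists2 e : R, 0 < e & forall q, `|a - q| < e -> J q /\ U (c q).
  by apply: near_end => //; apply: Uc; rewrite lexx.
have [eb eb0 ebP] : exists2 e : R, 0 < e & forall q, `|b - q| < e -> J q /\ U (c q).
  by apply: near_end => //; apply: Uc; rewrite lexx ab.
pose I : set R := `]a - ea, b + eb[%classic.
have IJU r : I r -> J r /\ U (c r).
  rewrite /I/= in_itv/= => /andP[ar rb].
  have [ra|ra] := ltP r a; first by apply: eaP; rewrite gtr0_norm ?subr_gt0// ltrBlDl -ltrBlDr.
  have [br|rb'] := ltP b r; first by apply: ebP; rewrite ltr0_norm ?subr_lt0// opprB ltrBlDl.
  by split; [apply: (iJ a b); rewrite ?ra | apply: Uc; rewrite ra].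
have abI r : a <= r <= b -> I r.
  move=> /andP[ar rb]; rewrite /I/= in_itv/=.
  by rewrite (lt_le_trans _ ar) ?gtrBl// (le_lt_trans rb)// ltrDl.
apply: same_leaf_step; first exact: same_leaf_refl.
exists U, h, I, c, s, t; split; last split.
- split=> // e ea'; apply: Cinf_subset (sh e ea').
  by move=> _ [p [ep _] <-]; exists p.
- split; first by split; [exact: interval_open | exact: interval_is_interval].
    by move=> r /IJU[].
  by apply: trajectory_subset hc => r /IJU[].
- by split=> //; exact: abI.
Qed.

End Trajectories.

Section Flow.
Context {R : realType} {d : nat} (X : poisson_manifold R d) (h : X -> R)
  (D : set (R * X)) (phi : R -> X -> X) (flow_h : is_flow h D phi).

Lemma flow_open_interval x : open_interval [set t | D (t, x)].
Proof.
split; last exact: (flow_domain_interval flow_h).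
apply: (@open_comp _ _ (fun t : R => (t, x)) D) => [t _|].
  exact: (cvg_pair cvg_id (cvg_cst x)).
exact: (flow_domain_open flow_h).
Qed.

(** Maximality is used twice: the trajectory of x, restarted at time t, is the
trajectory of phi t x; hence the latter, started t earlier, passes through x at
time 0 and extends the trajectory of x. *)
Lemma flow_domainD (s t : R) x : D (t, x) -> D (s, phi t x) -> D (s + t, x).
Proof.
move=> Dt Ds; have flow_traj z : trajectory h [set t | D (t, z)] (fun t => phi t z).
  exact: flow_trajectory.
have later r : D (r + t, x) -> D (r, phi t x) /\ phi r (phi t x) = phi (r + t) x.
  have J0 : [set r | D (r + t, x)] 0 by rewrite /= add0r.
  have c0 : phi (0 + t) x = phi t x by rewrite add0r.
  exact: (flow_maximal flow_h (c := fun r => phi (r + t) x) (t := r)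
    (open_interval_shift _ t (flow_open_interval x)) J0 c0
    (trajectory_shift _ _ _ _ t (flow_traj x))).
have [DNt pNt] : D (- t, phi t x) /\ phi (- t) (phi t x) = x.
  have [|DNt ->] := later (- t); first by rewrite addNr; exact: (flow_domain0 flow_h).
  by rewrite addNr (flow0 flow_h).
have J0 : [set r | D (r - t, phi t x)] 0 by rewrite /= add0r.
have c0 : phi (0 - t) (phi t x) = x by rewrite add0r.
have [|//] := flow_maximal flow_h (c := fun r => phi (r - t) (phi t x))
  (open_interval_shift _ (- t) (flow_open_interval (phi t x))) J0 c0
  (trajectory_shift _ _ _ _ (- t) (flow_traj (phi t x))) (t := s + t).
by rewrite /= addrK.
Qed.

(** By compactness there is one e > 0 such that every point of K flows for all
times shorter than e.  A time t is then reached in n steps of length t / n. *)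
Lemma flow_complete_on_compact (K : set X) y : compact K ->
  (forall t, D (t, y) -> K (phi t y)) -> forall t, D (t, y).
Proof.
move=> /compact_near_coveringP cov Ky t.
have : \forall s \near (0 : R), K `<=` [set p | D (s, p)].
  apply: (cov _ (nbhs (0 : R)) (fun s p => D (s, p)) (nbhs_filter 0)) => p _.
  have : nbhs ((0 : R), p) D.
    apply: open_nbhs_nbhs; split; first exact: (flow_domain_open flow_h).
    exact: (flow_domain0 flow_h).
  by case=> -[A B] [nA nB] AB; exists (B, A) => // -[q s] [Bq As]; apply: AB.
move=> /nbhs_ballP[e /= e0]; rewrite -ball_normE => eD.
have [n tn] : exists n : nat, `|t| < n%:R * e.
  exists (Num.truncn (`|t| / e)).+1; rewrite -ltr_pdivrMr//.
  exact: Num.Theory.truncnS_gt.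
have n0 : (0 < n)%N by case: n tn => //; rewrite mul0r ltNge normr_ge0.
have stepn : `|t / n%:R| < e.
  by rewrite normrM normfV normr_nat ltr_pdivrMr ?ltr0n// mulrC.
suff /(_ n) : forall m : nat, D (m%:R * (t / n%:R), y).
  by rewrite mulrC divfK// pnatr_eq0 -lt0n.
elim=> [|m IH]; first by rewrite mul0r; exact: (flow_domain0 flow_h).
rewrite -natr1 mulrDl mul1r addrC; apply: flow_domainD => //.
by apply: eD; [rewrite /ball_/= sub0r normrN | exact: Ky].
Qed.
End Flow.

(** * The energy-Casimir method *)

Section EnergyCasimir.
Context {R : realType} {d : nat} (X : poisson_manifold R d).

(** On B, the function h + C has a strict local extremum at xe; on T2U U xe the
function C is constant, so the energy itself isolates xe there. *)
Lemma energy_casimir_isolated (h C : X -> R) (U B : set X) (xe : X) :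
  open U -> U xe -> smooth_on setT h -> casimir U C -> smooth_on U C ->
  tame U h xe -> B xe ->
  tangent B xe `<=` linspan (tangent (T2U U xe) xe) ->
  hessian_definite (fun x => h x + C x) B xe ->
  \forall y \near xe, B y -> T2U U xe y -> y <> xe -> h y <> h xe.
Proof.
move=> oU Uxe sh cC sC tame_h Bxe TB [k [a [[kd [aa aB] axe] def]]].
pose F := (h \o cinv a) \+ (C \o cinv a).
pose W := a @` (cdom a `&` U).
have oW : open W by exact: chart_image_open.
have Wxe : W (a xe) by exists xe.
have cF : Cinf W F.
  apply: CinfD => //; last exact: sC.
  by apply: Cinf_subset (sh a aa) => _ [x [ax _] <-]; exists x.
have shxe := smooth_onT_near _ h xe sh.
have sCxe : smooth_near xe C by exists U.
(* dh kills the tangent vectors of T2U U xe by tameness and dC does because C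
   is constant there; the slice directions lie in their span. *)
have crit v : in_slice k v -> 'D_v F (a xe) = 0.
  move=> vk; have [w /TB Tw wE] := slice_tangent _ _ _ _ _ v (conj aa aB) axe Bxe vk.
  have dh := smooth_near_chart _ _ _ _ aa axe shxe.
  have dC := smooth_near_chart _ _ _ _ aa axe sCxe.
  rewrite /F deriveD; [|exact: diff_derivable|exact: diff_derivable].
  rewrite -!wE// (linspan_vanish _ _ _ tame_h _ Tw) add0r.
  apply: linspan_vanish Tw => u Tu; apply: tangent_constant Tu => // x.
  exact: casimir_T2U.
have [s pos] : exists s : R, forall v, in_slice k v -> v != 0 ->
    0 < s * hessian F (a xe) v v.
  case: def => def; [exists 1 | exists (-1)] => v vk v0.
    by rewrite mul1r; exact: def.
  by rewrite mulN1r oppr_gt0; exact: def.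
have iso := definite_critical_isolated _ _ _ _ _ oW cF Wxe crit pos.
have near_iso : \forall y \near xe,
    in_slice k (a y - a xe) -> a y != a xe -> F (a y) != F (a xe).
  exact: (cmap_continuous axe) iso.
have near_dom : \forall y \near xe, cdom a y.
  by apply: open_nbhs_nbhs; split; [exact: cdom_open|].
apply: filterS2 near_iso near_dom => y isoy ay By Ty yxe hy.
have /negP[] : F (a y) != F (a xe).
  apply: isoy; last first.
    by apply: contra_notN yxe => /eqP ayxe; rewrite -(cmapK ay) ayxe cmapK.
  by move=> j kj; rewrite !mxE (aB y ay).1// (aB xe axe).1// subrr.
by rewrite /F/= !cmapK// hy (casimir_T2U _ _ _ _ _ cC Ty).
Qed.

(** Topological core of the method.  Here K is a compact neighbourhood of xe
inside the given open set O, G is an open one inside K, and K `&` ~` G plays the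
part of the frontier that an escaping trajectory has to meet. *)
Lemma T2_isolated_level_stable (h : X -> R) (D : set (R * X))
    (phi : R -> X -> X) (U : set X) (xe : X) :
  smooth_on setT h -> is_flow h D phi -> open U -> U xe ->
  (\forall y \near xe, T2U U xe y -> y <> xe -> h y <> h xe) ->
  stable D phi xe.
Proof.
move=> sh flow_h oU Uxe iso O oO Oxe.
have [a aa axe] := atlas_cover xe.
have [|K [G [cK oG Gxe GK KV]]] := @compact_nbhs R d X a xe
  (U `&` O `&` [set y | T2U U xe y -> y <> xe -> h y <> h xe]) axe.
  by apply: filterI => //; apply: filterI; exact: open_nbhs_nbhs.
have KU x : K x -> U x by move=> /KV[[]].
have KO x : K x -> O x by move=> /KV[[]].
have clK : closed K by exact: compact_closed (@manifold_hausdorff _ _ X) cK.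
have clG : closure G `<=` K.
  by rewrite (closure_id K).1//; exact: closureS.
have ch x : {for x, continuous h}.
  exact/smooth_near_continuous/smooth_onT_near.
have cKG : compact (K `&` ~` G) by apply: compact_closedI => //; exact: open_closedC.
(* Starting points near xe are connected to no point of K `&` ~` G by a
   trajectory, since that would preserve both the leaf and the energy. *)
have sep : \forall y \near xe,
    K `&` ~` G `<=` [set z | ~ (same_leaf U y z /\ h y = h z)].
  move/compact_near_coveringP : cKG => cov.
  apply: (cov _ (nbhs xe) (fun y z => ~ (same_leaf U y z /\ h y = h z))
    (nbhs_filter xe)) => z [Kz Gz].
  have [Tz|nTz] := pselect (T2U U xe z); last first.
    apply: filterS (T2U_separated X U xe z oU Uxe (KU z Kz) nTz) => -[z' y] /= nyz.
    by case.
  have zxe : z <> xe by move=> zxe; apply: Gz; rewrite zxe.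
  have hzxe : h xe - h z != 0.
    by rewrite subr_eq0; apply/eqP => /esym; exact: (KV z Kz).2 Tz zxe.
  have cq : h q.2 - h q.1 @[q --> (z, xe)] --> h xe - h z.
    apply: cvgB.
      apply: (@cvg_comp _ _ _ snd h); [exact: cvg_snd | exact: ch].
    apply: (@cvg_comp _ _ _ fst h); [exact: cvg_fst | exact: ch].
  have nz : \forall q \near (z, xe), h q.2 - h q.1 != 0.
    exact: (cvgr_neq0 _ cq hzxe).
  by apply: filterS nz => -[z' y] /= + [_ hyz]; rewrite hyz subrr eqxx.
exists (G `&` [set y |
    K `&` ~` G `<=` [set z | ~ (same_leaf U y z /\ h y = h z)]]).
  by apply: filterI => //; exact: open_nbhs_nbhs.
move=> y [Gy sepy].
have [oJ iJ] := flow_open_interval X h D phi flow_h y.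
have traj : trajectory h [set t | D (t, y)] (fun t => phi t y).
  exact: flow_trajectory.
have y0 : phi 0 y = y by exact: (flow0 flow_h).
have Jy0 : D (0, y) by exact: (flow_domain0 flow_h).
(* At a first exit from G the trajectory is in K `&` ~` G. *)
have stay t : D (t, y) -> G (phi t y).
  move=> Dt; apply: contrapT => Gt.
  have G0 : G (phi 0 y) by rewrite y0.
  have [u [v [Ju Jv uv clo [s usv Gs]]]] := exit_interval
    (fun t => phi t y) G [set t | D (t, y)] t iJ Jy0 Dt
    (fun r Jr => (traj r Jr).1) oG G0 Gt.
  have Ks : K (phi s y) by apply: clG; exact: clo.
  apply: (sepy _ (conj Ks Gs)); split.
    rewrite -{1}y0; apply: (trajectory_same_leaf X U h _ (fun t => phi t y) u v 0 s oU sh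
      (conj oJ iJ) traj Ju Jv) => // r ruv; exact/KU/clG/clo.
  rewrite -{1}y0; apply: (energy_conserved X h _ (fun t => phi t y) 0 s sh iJ traj) => //.
  exact: iJ Ju Jv s usv.
have Dy : forall t, D (t, y).
  by apply: (flow_complete_on_compact X h D phi flow_h K) => // t /stay /GK.
by move=> t; split; [exact: Dy | exact/KO/GK/stay/Dy].
Qed.

End EnergyCasimir.

Theorem theorem3p6 (R : realType) (d : nat) (X : poisson_manifold R d)
    (h : X -> R) (h_smooth : smooth_on setT h)
    (D : set (R * X)) (phi : R -> X -> X) (flow_h : is_flow h D phi)
    (xe : X) (xe_eq : equilibrium D phi xe)
    (U : set X) (U_open : open U) (U_xe : U xe) (xe_tame : tame U h xe)
    (n : nat) (B : 'I_n -> set X) (B_smoothing : smoothing (T2U U xe) xe B) :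
  (forall i : 'I_n, exists C : X -> R,
     [/\ casimir U C, smooth_on U C &
         hessian_definite (fun x => h x + C x) (B i) xe]) ->
  stable D phi xe.
Proof.
have [Bxe SB TB] := B_smoothing => HC.
apply: (T2_isolated_level_stable X h D phi U) => //.
have iso : \forall y \near xe, forall i : 'I_n,
    B i y -> T2U U xe y -> y <> xe -> h y <> h xe.
  apply: filter_forall => i; have [C [cC sC def]] := HC i.
  exact: energy_casimir_isolated cC sC xe_tame (Bxe i).1 (TB i) def.
by apply: filterS iso => y isoy Ty; have [i _ Biy] := SB y Ty; exact: isoy Biy Ty.
Qed.
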